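(* Let $G=(V,E)$ be a $d$-regular graph on $n$ vertices and let $\mu=\mu(G)$. Let $S\subset V$ with $|S|=\alpha n$, and let $\overline S=V\setminus S$. Then $$|\partial S|\ \geq\ \frac{d^2|S|}{\alpha(d^2-\mu^2)+\mu^2}$$ and $$\bigl|\{v\in V: S\cap\partial v=\emptyset\}\bigr|\ \leq\ \frac{\mu^2|\overline S|}{\alpha(d^2-\mu^2)+\mu^2}.$$
   Context: Graphs are finite, simple and undirected, with $n\ge 2$ vertices and $d\ge1$. For a graph $G$ on $n$ vertices with adjacency matrix $A$ and eigenvalues $\lambda_0\ge\lambda_1\ge\cdots\ge\lambda_{n-1}$ of $A$ (with multiplicity), $\mu(G)=\max\{\lambda_1,|\lambda_{n-1}|\}$. For $v\in V$, $\partial v=\{u\in V:(u,v)\in E\}$ is the set of neighbours of $v$, and for $S\subset V$, $\partial S=\bigcup_{v\in S}\partial v=\{u\in V: S\cap\partial u\ne\emptyset\}$ (which may intersect $S$). *)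

(* Defs.v *)
From mathcomp Require Import all_boot all_order all_algebra.
From mathcomp Require Import polyrcf.

Set Implicit Arguments.
Unset Strict Implicit.
Unset Printing Implicit Defensive.

Import Order.TTheory GRing.Theory Num.Theory.
Local Open Scope ring_scope.

(* A finite simple graph is a symmetric irreflexive relation on a finType. *)

Definition neighbours (T : finType) (e : rel T) (v : T) : {set T} :=
  [set u | e u v].

Definition boundary (T : finType) (e : rel T) (S : {set T}) : {set T} :=
  \bigcup_(v in S) neighbours e v.

Definition regular (T : finType) (e : rel T) (d : nat) : Prop :=
  forall v : T, #|neighbours e v| = d.

(* Vertices are numbered by [enum T]; the spectrum does not depend on this. *)
Definition adjacency_mx (R : rcfType) (T : finType) (e : rel T) : 'M[R]_#|T| :=
  \matrix_(i, j) (e (enum_val i) (enum_val j))%:R.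

(* The eigenvalues of M in R, in nonincreasing order, each repeated according
   to its multiplicity as a root of the characteristic polynomial.  For a
   symmetric M the characteristic polynomial splits over R, so that the
   sequence has length n. *)
Definition eigenvalues (R : rcfType) (n : nat) (M : 'M[R]_n) : seq R :=
  let p := char_poly M in
  sort >=%R (flatten [seq nseq (mup x p) x | x <- rootsR p]).

(* mu(G) = max {lambda_1, |lambda_(n-1)|}, with eigenvalues numbered from 0. *)
Definition graph_mu (R : rcfType) (T : finType) (e : rel T) : R :=
  let lam := eigenvalues (adjacency_mx R e) in
  Num.max lam`_1 `|lam`_(#|T|.-1)|.

(* Main.v *)
(* Let f be the indicator of S and h = A f, so that h is supported on the
   boundary of S and has total mass d |S|.  Writing f = alpha 1 + g with g
   orthogonal to 1, one gets |h|^2 = d^2 alpha^2 n + |A g|^2, and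
   |A g| <= mu |g| because the all-ones vector is an eigenvector for the largest
   eigenvalue d.  The Cauchy-Schwarz inequality on the boundary of S then gives
   the first bound, and the second is the first one after complementation.
   The inequality |A g| <= mu |g| is read off a unitary diagonalization of A
   over the complex extension R[i]. *)
Require Import Defs.
From mathcomp Require Import all_boot all_order all_algebra.
From mathcomp Require Import polyrcf complex spectral ring lra.

Set Implicit Arguments.
Unset Strict Implicit.
Unset Printing Implicit Defensive.

Import Order.TTheory GRing.Theory Num.Theory.
Local Open Scope ring_scope.

(** * Root multiplicities and the list of eigenvalues *)

Lemma mup_prod_XsubC (F : fieldType) (s : seq F) (x : F) :
  mup x (\prod_(y <- s) ('X - y%:P)) = count_mem x s.
Proof.
elim: s => [|y s IHs].
  by rewrite big_nil mupNroot // rootC oner_eq0.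
rewrite big_cons mupM ?polyXsubC_eq0 ?monic_neq0 ?monic_prod_XsubC //.
by rewrite IHs -['X - _]expr1 mup_XsubCX /=; case: eqVneq.
Qed.

(** Both lists contain each [x] exactly [mup x (char_poly M)] times: [rootsR] lists every root once,
    so a single block of the flattened list contributes copies of [x], and none does if [x] is not a
    root. *)
Lemma perm_eigenvalues (R : rcfType) (n : nat) (M : 'M[R]_n) (s : seq R) :
  char_poly M = \prod_(x <- s) ('X - x%:P) -> perm_eq (eigenvalues M) s.
Proof.
move=> Ms; rewrite /eigenvalues perm_sort; apply/allP => x _ /=; apply/eqP.
rewrite -[RHS]mup_prod_XsubC -Ms.
have p_neq0 : char_poly M != 0 by rewrite monic_neq0 ?char_poly_monic.
have rootsE y : (y \in rootsR (char_poly M)) = root (char_poly M) y.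
  by rewrite -(roots_on_rootsR p_neq0) in_itv.
rewrite count_flatten -map_comp sumnE big_map.
under eq_bigr => y _ do rewrite /= count_nseq /= eq_sym.
have [xr|xNr] := boolP (root (char_poly M) x).
  rewrite (bigD1_seq x) ?rootsE ?uniq_roots //= eqxx mul1n.
  by rewrite big1 ?addn0 // => y /negPf; rewrite eq_sym => ->.
rewrite mupNroot // big_seq big1 // => y; rewrite rootsE.
by case: eqVneq xNr => //= <- /negPf->.
Qed.

Lemma char_poly_conj (F : fieldType) (n : nat) (P A : 'M[F]_n) :
  P \in unitmx -> char_poly (invmx P *m A *m P) = char_poly A.
Proof.
move=> Pu; rewrite /char_poly /char_poly_mx.
have PuX : map_mx polyC P \in unitmx by rewrite map_unitmx.
have -> : 'X%:M - map_mx polyC (invmx P *m A *m P) =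
  invmx (map_mx polyC P) *m ('X%:M - map_mx polyC A) *m map_mx polyC P.
  rewrite mulmxBr mulmxBl !map_mxM /= map_invmx scalar_mxC mulmxKV //.
by rewrite !det_mulmx mulrAC -det_mulmx mulVmx // det1 mul1r.
Qed.

(** * Diagonalization and the norm bound orthogonally to a top eigenvector *)

Local Open Scope sesquilinear_scope.

(** Over [R[i]] the matrix is Hermitian, hence normal, and the spectral theorem applies; its
    diagonal is real and so comes from a row [a] over [R]. *)
Lemma symmetric_diagonalization (R : rcfType) (n : nat) (M : 'M[R]_n) :
  M^T = M ->
  exists (P : 'M[R[i]]_n) (a : 'rV[R]_n),
    [/\ P \is unitarymx,
        P *m map_mx (real_complex R) M
          = diag_mx (map_mx (real_complex R) a) *m P
      & char_poly M = \prod_(x <- codom (a 0)) ('X - x%:P)].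
Proof.
move=> Msym; set MC := map_mx (real_complex R) M.
have MCr : MC \is a realmx.
  by apply/mxOverP => i j; rewrite mxE; apply/complex_realP; exists (M i j).
have MCh : MC \is hermsymmx.
  apply: realsym_hermsym => //; apply/is_hermitianmxP.
  by rewrite expr0 scale1r map_mx_id // map_trmx Msym.
have /orthomx_spectralP MCE := hermitian_normalmx MCh.
have /mxOverP ar := hermitian_spectral_diag_real MCh.
pose a : 'rV[R]_n := \row_j complex.Re (spectral_diag MC 0 j).
have aE : map_mx (real_complex R) a = spectral_diag MC.
  by apply/rowP => j; rewrite !mxE RRe_real.
exists (spectralmx MC), a; rewrite aE; split.
- exact: spectral_unitarymx.
- by rewrite {2}MCE -!mulmxA mulKVmx ?spectral_unit.
(* The factorization may be checked over [R[i]], where [M] is conjugate to a diagonal matrix. *)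
apply: (@map_inj_poly _ _ (real_complex R)).
- exact: complexI.
- exact: rmorph0.
rewrite map_char_poly /= -/MC {1}MCE char_poly_conj ?spectral_unit //.
rewrite char_poly_trig ?diag_mx_is_trig // -aE rmorph_prod /= big_image /=.
apply: eq_bigr => j _.
by rewrite rmorphB /= map_polyX map_polyC /= 2!mxE eqxx mulr1n.
Qed.

(** In a nonincreasing list only the head can exceed the entry at index 1. Counting with
    multiplicity carries this over to the indices of [a]. *)
Lemma sorted_gt_second_unique (R : realDomainType) (I : finType)
    (a : I -> R) (s : seq R) :
  sorted >=%R s -> perm_eq s (codom a) ->
  {in [pred i | s`_1 < a i] &, forall i j, i = j}.
Proof.
move=> s_sorted /permP/(_ [pred x | s`_1 < x]).
have -> : count [pred x | s`_1 < x] (codom a) = #|[pred i | s`_1 < a i]|.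
  rewrite count_map cardE /enum_mem size_filter -enumT enumT count_filter.
  by apply: eq_count => i; rewrite inE andbT.
move=> countE; suff /card_le1_eqP le1 : (#|[pred i | (s`_1 < a i)%R]| <= 1)%N.
  by move=> i j ilt jlt; apply: le1.
rewrite -countE; case: s s_sorted {countE} => [|x [|y s]] //=.
  (* For a singleton the entry at index 1 is the default 0, and the count is at most 1 all the
     same. *)
  by case: (_ < _).
case/andP=> _ s_path; rewrite ltxx add0n.
rewrite (eqP (_ : count _ s == 0)%N) ?addn0 ?leq_b1 //.
rewrite eqn0Ngt -has_count -all_predC; apply/allP => z zs /=.
rewrite -leNgt.
by have /allP -> := order_path_min (rev_trans le_trans) s_path.
Qed.

(** [P] preserves the Hermitian product, which is the usual dot product on real vectors. This
    transfers both norms and orthogonality to eigencoordinates. *)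
Lemma unitary_dot (R : rcfType) (n : nat) (P : 'M[R[i]]_n) (x y : 'cV[R]_n) :
  P \is unitarymx ->
  \sum_i ((P *m map_mx (real_complex R) x) i 0)^*
         * (P *m map_mx (real_complex R) y) i 0
    = real_complex R (\sum_i x i 0 * y i 0).
Proof.
move=> Pu; set X := map_mx _ x; set Y := map_mx _ y.
transitivity (((P *m X)^t* *m (P *m Y)) 0 0).
  by rewrite mxE; apply: eq_bigr => i _; rewrite !mxE.
rewrite trmx_mul map_mxM /= mulmxA -(mulmxA _ _ P) -invmx_unitary //.
rewrite mulVmx ?unitarymx_unit // mulmx1 mxE rmorph_sum /=.
apply: eq_bigr => i _; rewrite !mxE rmorphM /=; congr (_ * _).
exact: conjc_real.
Qed.

(** In the coordinates [c x] the matrix acts diagonally by [a], so it suffices to bound [a 0 i] in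
    absolute value wherever [c v] is nonzero. *)
Lemma second_eigenvalue_bound (R : rcfType) (n : nat) (M : 'M[R]_n)
    (w v : 'cV[R]_n) (r : R) (s := eigenvalues M) :
  M^T = M -> w != 0 -> M *m w = r *: w ->
  (forall x, root (char_poly M) x -> x <= r) ->
  \sum_i w i 0 * v i 0 = 0 ->
  \sum_i (M *m v) i 0 ^+ 2
    <= Num.max s`_1 `|s`_n.-1| ^+ 2 * \sum_i v i 0 ^+ 2.
Proof.
move=> Msym w_neq0 Mw r_max wv0; set mu := Num.max _ _.
have [P [a [Pu PM cpM]]] := symmetric_diagonalization Msym.
have s_perm : perm_eq s (codom (a 0)) by apply: perm_eigenvalues.
have s_sorted : sorted >=%R s by apply: sort_sorted => x y; apply: le_total.
pose c (x : 'cV[R]_n) := P *m map_mx (real_complex R) x.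
have cM x i : c (M *m x) i 0 = real_complex R (a 0 i) * c x i 0.
  by rewrite /c map_mxM mulmxA PM -mulmxA mul_diag_mx !mxE.
have a_ge i : s`_n.-1 <= a 0 i.
  have : a 0 i \in s by rewrite (perm_mem s_perm) codom_f.
  have ss : size s = n by rewrite (perm_size s_perm) size_codom card_ord.
  move=> as_; rewrite -(nth_index 0 as_).
  have n_gt0 : (0 < n)%N by rewrite -ss; case: (s) as_.
  apply: (sorted_leq_nth (rev_trans le_trans) (@le_refl _ R)) => //.
  - by rewrite inE index_mem.
  - by rewrite inE ss prednK.
  - have := as_; rewrite -index_mem ss; move: (index _ _) => k kn.
    by rewrite -ltnS prednK.
have a_le i : a 0 i <= r.
  apply: r_max; rewrite cpM root_prod_XsubC; exact: codom_f.
(* If a_i exceeds the second largest eigenvalue then a_i = r is simple, so that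
   w is supported on the i-th coordinate and v, orthogonal to w, has none. *)
have ac i : c v i 0 != 0 -> `|a 0 i| <= mu.
  move=> cv; have [ai|ai] := leP (a 0 i) s`_1.
    rewrite ler_norml lerNl 2!le_max ai andbT; apply/orP; right.
    by rewrite -normrN (le_trans _ (ler_norm _)) // lerN2.
  have s1_uniq := sorted_gt_second_unique s_sorted s_perm.
  have [j cwj] : exists j, c w j 0 != 0.
    apply/existsP; apply: contraNT w_neq0 => /existsPn cw0.
    have c0 : c w = 0.
      by apply/matrixP=> j k; rewrite ord1 [RHS]mxE; apply/eqP/negPn/cw0.
    rewrite -(map_mx_eq0 (real_complex R)).
    rewrite -[X in X == 0](mulKmx (unitarymx_unit Pu)).
    by rewrite -/(c w) c0 mulmx0.
  have cw_eig k : c w k 0 != 0 -> a 0 k = r.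
    move=> cwk; have := cM w k; rewrite Mw /c map_mxZ -scalemxAr mxE -/(c w).
    by move=> /(mulIf cwk) /complexI.
  have E k : c w k 0 != 0 -> k = i.
    move=> cwk; apply: s1_uniq; rewrite inE // cw_eig //.
    exact: lt_le_trans ai (a_le i).
  have := unitary_dot w v Pu; rewrite wv0 rmorph0.
  rewrite (bigD1 i) //= big1 => [|k ki]; last first.
    rewrite -/(c w).
    have [->|/E ki'] := eqVneq (c w k 0) 0; first by rewrite conjC0 mul0r.
    by rewrite ki' eqxx in ki.
  rewrite -/(c w) -/(c v) addr0 => /eqP.
  rewrite mulf_eq0 conjC_eq0 (negPf cv) orbF.
  by rewrite -(E _ cwj) (negPf cwj).
have mu_ge0 : 0 <= mu by rewrite le_max normr_ge0 orbT.
have sq x : \sum_i `|c x i 0| ^+ 2 = real_complex R (\sum_i x i 0 ^+ 2).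
  under [in RHS]eq_bigr => i _ do rewrite expr2.
  rewrite -(unitary_dot _ _ Pu); apply: eq_bigr => i _.
  by rewrite normCK mulrC.
(* By unitarity both sums of squares can be taken in the coordinates [c] and compared term by
   term. *)
rewrite -lecR rmorphM /= -!sq mulr_sumr; apply: ler_sum => i _.
rewrite cM normrM exprMn.
have [->|/ac ai] := eqVneq (c v i 0) 0.
  by rewrite normr0 expr0n /= !mulr0.
rewrite ler_wpM2r ?exprn_ge0 //.
rewrite rmorphXn /= normc_def /= expr0n addr0 sqrtr_sqr -!rmorphXn lecR.
by rewrite lerXn2r ?nnegrE.
Qed.

Local Close Scope sesquilinear_scope.

(** * The adjacency matrix of a regular graph *)

Lemma sum_indicator (R : pzSemiRingType) (T : finType) (A : {set T}) :
  \sum_v (v \in A)%:R = #|A|%:R :> R.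
Proof.
rewrite -sum1_card natr_sum [RHS]big_mkcond.
by apply: eq_bigr => v _; case: (v \in A).
Qed.

Lemma sum_adjacency (R : pzSemiRingType) (T : finType) (e : rel T) (d : nat)
    (u : T) :
  symmetric e -> regular e d -> \sum_v (e u v)%:R = d%:R :> R.
Proof.
move=> e_sym /(_ u) <-; rewrite -sum_indicator.
by apply: eq_bigr => v _; rewrite inE e_sym.
Qed.

Lemma sum_enum_val (R : nmodType) (T : finType) (g : T -> R) :
  \sum_u g u = \sum_(i < #|T|) g (enum_val i).
Proof. exact: big_enum_val. Qed.

Lemma adjacency_mul (R : rcfType) (T : finType) (e : rel T) (f : T -> R) :
  adjacency_mx R e *m \col_i f (enum_val i)
    = \col_i \sum_v (e (enum_val i) v)%:R * f v.
Proof.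
apply/matrixP => i j; rewrite !mxE [RHS]sum_enum_val.
by apply: eq_bigr => k _; rewrite !mxE.
Qed.

(** Read the eigenvector equation at a coordinate of maximal absolute value: the triangle inequality
    bounds the sum there by [d] times that maximum. *)
Lemma adjacency_eigenvalue_le (R : rcfType) (T : finType) (e : rel T) (d : nat)
    (x : R) :
  symmetric e -> regular e d ->
  root (char_poly (adjacency_mx R e)) x -> x <= d%:R.
Proof.
move=> e_sym e_reg; rewrite -eigenvalue_root_char => /eigenvalueP [v vA v_neq0].
have [j0 vj0] : exists j, v 0 j != 0 by apply/rV0Pn.
have [i _ i_max] := arg_maxP (fun j => `|v 0 j|) (isT : xpredT j0).
have vi_gt0 : 0 < `|v 0 i| by rewrite (lt_le_trans _ (i_max j0 _)) ?normr_gt0.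
rewrite (le_trans (ler_norm x)) // -(ler_pM2r vi_gt0) -normrM.
have := congr1 (fun m : 'rV_#|T| => m 0 i) vA; rewrite !mxE => <-.
apply: le_trans (ler_norm_sum _ _ _) _.
rewrite -(sum_adjacency R (enum_val i) e_sym e_reg) (sum_enum_val (T := T)).
rewrite mulr_suml.
apply: ler_sum => j _; rewrite mxE normrM mulrC e_sym ger0_norm //.
by apply: ler_wpM2l => //; apply: i_max.
Qed.

(** By regularity the all-ones vector is an eigenvector for [d], the top eigenvalue, and [f] is
    orthogonal to it. *)
Lemma graph_mu_bound (R : rcfType) (T : finType) (e : rel T) (d : nat)
    (f : T -> R) :
  symmetric e -> regular e d -> \sum_v f v = 0 ->
  \sum_u (\sum_v (e u v)%:R * f v) ^+ 2 <= graph_mu R e ^+ 2 * \sum_v f v ^+ 2.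
Proof.
move=> e_sym e_reg f0.
have [T0|/card_gt0P [t _]] := posnP #|T|.
  by rewrite !big1 ?mulr0 // => u; have := card0_eq T0 u.
have lhsE : \sum_u (\sum_v (e u v)%:R * f v) ^+ 2
    = \sum_i (adjacency_mx R e *m \col_i f (enum_val i)) i 0 ^+ 2.
  by rewrite adjacency_mul sum_enum_val; apply: eq_bigr => i _; rewrite mxE.
have rhsE : \sum_v f v ^+ 2
    = \sum_i ((\col_(i < #|T|) f (enum_val i)) i 0 : R) ^+ 2.
  by rewrite sum_enum_val; apply: eq_bigr => i _; rewrite mxE.
rewrite lhsE rhsE.
apply: (second_eigenvalue_bound (w := const_mx 1) (r := d%:R)).
- by apply/matrixP => i j; rewrite !mxE e_sym.
- by apply/cV0Pn; exists (enum_rank t); rewrite mxE oner_eq0.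
- apply/matrixP => i j; rewrite !mxE mulr1.
  rewrite -(sum_adjacency R (enum_val i) e_sym e_reg).
  rewrite (sum_enum_val (T := T)).
  by apply: eq_bigr => k _; rewrite !mxE mulr1.
- by move=> x; apply: adjacency_eigenvalue_le.
- rewrite -[RHS]f0 (sum_enum_val (T := T)).
  by apply: eq_bigr => i _; rewrite !mxE mul1r.
Qed.

(** For an edge between [u] and [v], the difference of their indicators has sum 0, while its image
    under the adjacency matrix is 1 at [u]; hence [mu] cannot vanish. This keeps the denominator of
    the theorem positive when [S] is empty. *)
Lemma graph_mu_gt0 (R : rcfType) (T : finType) (e : rel T) (d : nat) :
  symmetric e -> irreflexive e -> regular e d -> (0 < d)%N -> (0 < #|T|)%N ->
  0 < graph_mu R e.
Proof.
move=> e_sym e_irr e_reg d_gt0 /card_gt0P [u _].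
have : (0 < #|neighbours e u|)%N by rewrite e_reg.
case/card_gt0P => v; rewrite inE => evu.
rewrite lt0r [X in _ && X]le_max normr_ge0 orbT andbT; apply/eqP => mu0.
have vu : v != u by apply: contraTneq evu => ->; rewrite e_irr.
pose f x : R := (x == v)%:R - (x == u)%:R.
have fE (h : T -> R) : \sum_x h x * f x = h v - h u.
  have D w : \sum_x h x * (x == w)%:R = h w.
    rewrite (bigD1 w) //= eqxx mulr1 big1 ?addr0 // => x /negPf ->.
    by rewrite mulr0.
  by under eq_bigr => x _ do rewrite mulrBr; rewrite sumrB !D.
have f0 : \sum_x f x = 0.
  by under eq_bigr => x _ do rewrite -[f x]mul1r; rewrite fE subrr.
have := graph_mu_bound e_sym e_reg f0; rewrite mu0 expr0n mul0r.
rewrite (bigD1 u) //= fE e_irr e_sym evu subr0 expr1n => le0.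
have : 1 <= 0 :> R.
  apply: le_trans le0; rewrite lerDl sumr_ge0 // => x _; exact: sqr_ge0.
by rewrite ler10.
Qed.

(** * The two neighbourhood bounds *)

Theorem lemma5 (R : rcfType) (T : finType) (e : rel T) (d : nat)
  (S : {set T}) (alpha : R)
  (e_sym : symmetric e) (e_irr : irreflexive e)
  (n_ge2 : (2 <= #|T|)%N) (d_ge1 : (1 <= d)%N) (e_reg : regular e d)
  (cardS : #|S|%:R = alpha * #|T|%:R) :
  let mu := graph_mu R e in
  d%:R ^+ 2 * #|S|%:R / (alpha * (d%:R ^+ 2 - mu ^+ 2) + mu ^+ 2)
    <= #|boundary e S|%:R
  /\
  #|[set v | S :&: neighbours e v == set0]|%:R
    <= mu ^+ 2 * #|~: S|%:R / (alpha * (d%:R ^+ 2 - mu ^+ 2) + mu ^+ 2).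
Proof.
move=> mu; set D := alpha * _ + _.
have n_gt0 : 0 < #|T|%:R :> R by rewrite ltr0n (leq_trans _ n_ge2).
have mu_gt0 : 0 < mu by apply: graph_mu_gt0 e_reg d_ge1 (ltnW n_ge2).
have d_gt0 : 0 < d%:R :> R by rewrite ltr0n.
have alpha_ge0 : 0 <= alpha by rewrite -(pmulr_lge0 _ n_gt0) -cardS.
have cardSC : #|~: S|%:R = (1 - alpha) * #|T|%:R.
  by rewrite mulrBl mul1r -cardS -(cardsC S) natrD addrAC subrr add0r.
have alpha_le1 : 0 <= 1 - alpha by rewrite -(pmulr_lge0 _ n_gt0) -cardSC.
have D_gt0 : 0 < D.
  (* [D] is a convex combination of the squares of [d] and [mu]. *)
  have -> : D = alpha * d%:R ^+ 2 + (1 - alpha) * mu ^+ 2 by rewrite /D; ring.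
  have [->|alpha_neq0] := eqVneq alpha 0.
    by rewrite mul0r add0r subr0 mul1r exprn_gt0.
  apply: ltr_pwDl; first by rewrite mulr_gt0 ?exprn_gt0 // lt0r alpha_neq0.
  by rewrite mulr_ge0 ?exprn_ge0 // ltW.
pose f v : R := (v \in S)%:R.
pose h u := \sum_v (e u v)%:R * f v.
have sumf : \sum_v f v = #|S|%:R := sum_indicator R S.
have sumh : \sum_u h u = d%:R * #|S|%:R.
  rewrite exchange_big /= -sumf mulr_sumr; apply: eq_bigr => v _.
  rewrite -mulr_suml -(sum_adjacency R v e_sym e_reg); congr (_ * _).
  by apply: eq_bigr => u _; rewrite e_sym.
have h0 u : u \notin boundary e S -> h u = 0.
  move=> uB; apply: big1 => v _; rewrite /f.
  have [vS|] := boolP (v \in S); last by rewrite mulr0.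
  case euv : (e u v); rewrite ?mul0r //.
  by case/negP: uB; apply/bigcupP; exists v => //; rewrite inE.
pose g v := f v - alpha.
have g0 : \sum_v g v = 0.
  by rewrite sumrB sumf sumr_const cardS mulr_natr subrr.
(* The last factor [alpha * (1 - alpha) * #|T|] is the squared norm of [g]. *)
have sumh2 : \sum_u h u ^+ 2 <= d%:R ^+ 2 * alpha ^+ 2 * #|T|%:R
    + mu ^+ 2 * (alpha * (1 - alpha) * #|T|%:R).
  have hE u : \sum_v (e u v)%:R * g v = h u - d%:R * alpha.
    under eq_bigr => v _ do rewrite mulrBr.
    by rewrite sumrB -mulr_suml (sum_adjacency R u e_sym e_reg).
  have := graph_mu_bound e_sym e_reg g0.
  under eq_bigr => u _ do rewrite hE.
  have sq (k : T -> R) c : \sum_u (k u - c) ^+ 2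
      = \sum_u k u ^+ 2 - 2 * c * \sum_u k u + c ^+ 2 * #|T|%:R.
    rewrite mulr_natr -sumr_const mulr_sumr -sumrB -big_split /=.
    by apply: eq_bigr => u _; ring.
  rewrite !sq sumh sumf.
  have -> : \sum_u f u ^+ 2 = #|S|%:R.
    rewrite -sumf; apply: eq_bigr => u _.
    by rewrite /f; case: (u \in S); rewrite ?expr1n ?expr0n.
  rewrite cardS -/mu; set X := \sum_u _; lra.
pose B := boundary e S.
(* The function h vanishes outside B; expand the square of h - c 1_B. *)
have ineqB (c : R) :
    0 <= \sum_u h u ^+ 2 - 2 * c * \sum_u h u + c ^+ 2 * #|B|%:R.
  have -> : \sum_u h u ^+ 2 - 2 * c * \sum_u h u + c ^+ 2 * #|B|%:R
      = \sum_u (h u - c * (u \in B)%:R) ^+ 2.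
    rewrite -sum_indicator !mulr_sumr -sumrB -big_split /=.
    apply: eq_bigr => u _.
    by have [uB|/h0 ->] := boolP (u \in B) => /=; ring.
  by apply: sumr_ge0 => u _; apply: sqr_ge0.
have boundB : d%:R ^+ 2 * #|S|%:R <= #|B|%:R * D.
  (* The bound in [sumh2] factors as [alpha * #|T|] times [D]. *)
  have Q_le : \sum_u h u ^+ 2 <= D * #|S|%:R.
    by apply: le_trans sumh2 _; rewrite cardS /D; lra.
  (* This choice of c gives the optimal bound. *)
  have := le_trans (ineqB (D / d%:R)) (lerD (lerD Q_le (lexx _)) (lexx _)).
  rewrite sumh.
  have -> : D * #|S|%:R - 2 * (D / d%:R) * (d%:R * #|S|%:R)
      + (D / d%:R) ^+ 2 * #|B|%:R
      = D / d%:R ^+ 2 * (#|B|%:R * D - d%:R ^+ 2 * #|S|%:R).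
    by field; rewrite gt_eqF.
  by rewrite pmulr_rge0 ?subr_ge0 ?divr_gt0 ?exprn_gt0.
split; first by rewrite ler_pdivrMr.
rewrite ler_pdivlMr //.
have -> : [set v | S :&: neighbours e v == set0] = ~: B.
  apply/setP => u; rewrite !inE; apply/eqP/idP => [SN|uB].
    apply/bigcupP => -[v vS]; rewrite inE => euv.
    by have := in_set0 v; rewrite -SN !inE vS e_sym euv.
  apply/eqP; apply: contraR uB => /set0Pn [v]; rewrite !inE => /andP[vS evu].
  by apply/bigcupP; exists v; rewrite // inE e_sym.
have -> : #|~: B|%:R = #|T|%:R - #|B|%:R :> R.
  by rewrite -(cardsC B) natrD addrAC subrr add0r.
(* Since [D - (1 - alpha) * mu ^+ 2] equals [alpha * d ^+ 2], the goal is a rearrangement of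
   [boundB]. *)
rewrite cardSC; move: boundB; rewrite cardS /D.
lra.
Qed.
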